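(* Let $E_i$, $i=1,2$, be two topological spaces endowed with a $\gamma_i$-quasi-metric $\rho_i$ respectively. Let $\xi$ and $\eta$ be $E_1$- and $E_2$-valued continuous adapted processes, respectively. Suppose that there is a constant $\kappa>0$ such that for all bounded stopping times $\tau'\leq\tau$, $$ \mathbb{E}\,\rho_1(\xi_{\tau},\xi_{\tau'})\leq\kappa\,\mathbb{E}\,\rho_2(\eta_{\tau},\eta_{\tau'}). $$ Then for any $\Phi\in\mathscr{A}_0$, there is a positive constant $C=C(\gamma_1,\gamma_2,\kappa,\Phi)$ (depending only on $\gamma_1,\gamma_2,\kappa,\Phi$) such that for any bounded stopping time $\tau>0$, $$ \mathbb{E}\left(\sup_{t\in[0,\tau]}\Phi\big(\rho_1(\xi_t,\xi_0)\big)\right)\leq C\,\mathbb{E}\left(\sup_{t\in[0,\tau]}\Phi\big(\rho_2(\eta_t,\eta_0)\big)\right). $$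
   Context: $(\Omega,\mathscr{F},(\mathscr{F}_t)_{t\geq 0},\mathbb{P})$ is a fixed stochastic basis satisfying the usual conditions; ''adapted'' and ''stopping time'' refer to $(\mathscr{F}_t)_{t\ge0}$. Quasi-metric: let $E$ be a topological space and $\gamma\geq 1$. A bi-continuous (i.e. jointly continuous) function $\rho:E\times E\to[0,\infty)$ is called a $\gamma$-quasi-metric on $E$ if (i) $\rho(x,y)=0$ if and only if $x=y$; (ii) $\rho(x,y)=\rho(y,x)$; (iii) $\rho(x,y)\leq\gamma(\rho(x,z)+\rho(y,z))$ for all $x,y,z\in E$. The class $\mathscr{A}_0$: a function $\Phi:(0,\infty)\to(0,\infty)$ is called moderately increasing if $\Phi$ is nondecreasing with $\lim_{s\to 0}\Phi(s)=0$ and for some $\lambda>1$ (and so, for all $\lambda>0$) there is $c_\lambda>0$ with $\Phi(\lambda t)\leq c_\lambda\Phi(t)$ for all $t$. $\mathscr{A}_0$ is the set of all moderately increasing functions. Such functions are extended by $\Phi(0):=0$. *)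

(* Defs.v *)
From HB Require Import structures.
From mathcomp Require Import all_boot all_order all_algebra.
From mathcomp Require Import all_classical all_reals all_analysis.

Set Implicit Arguments.
Unset Strict Implicit.
Unset Printing Implicit Defensive.

Import Order.TTheory GRing.Theory Num.Theory.
Import numFieldNormedType.Exports.

Local Open Scope classical_set_scope.
Local Open Scope ring_scope.

(* The standing requirement 1 <= gamma is a hypothesis wherever this is used. *)
Record quasi_metric (R : realType) (gamma : R) (E : topologicalType)
    (rho : E -> E -> R) : Prop := QuasiMetric {
  qm_continuous : continuous (fun p : E * E => rho p.1 p.2) ;
  qm_ge0 : forall x y, 0 <= rho x y ;
  qm_eq0 : forall x y, rho x y = 0 <-> x = y ;
  qm_sym : forall x y, rho x y = rho y x ;
  qm_triangle : forall x y z, rho x y <= gamma * (rho x z + rho y z) }.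

(* The class A_0. A function (0, oo) -> (0, oo) is represented by a function
   on R of which only the values at positive reals are ever used. *)
Record moderately_increasing (R : realType) (Phi : R -> R) : Prop :=
  ModeratelyIncreasing {
  mi_gt0 : forall s, 0 < s -> 0 < Phi s ;
  mi_nondecreasing : forall s t, 0 < s -> s <= t -> Phi s <= Phi t ;
  mi_cvg0 : Phi s @[s --> (0 : R)^'+] --> (0 : R) ;
  mi_doubling : exists2 lambda, 1 < lambda &
    exists2 c, 0 < c & forall t, 0 < t -> Phi (lambda * t) <= c * Phi t }.

(* Extension of Phi by Phi 0 := 0; negative arguments never occur. *)
Definition ext0 (R : realType) (Phi : R -> R) (s : R) : R :=
  if 0 < s then Phi s else 0.

(* Time is [0, oo): only the indices t >= 0 are constrained. *)
Record usual_filtration (R : realType) (d : measure_display)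
    (T : measurableType d) (P : probability T R) (F : R -> set (set T)) : Prop :=
  UsualFiltration {
  uf_sigma_algebra : forall t, 0 <= t -> sigma_algebra setT (F t) ;
  uf_measurable : forall t, 0 <= t -> F t `<=` measurable ;
  uf_nondecreasing : forall s t, 0 <= s -> s <= t -> F s `<=` F t ;
  uf_right_continuous : forall t, 0 <= t ->
    \bigcap_(s in [set s | t < s]) F s `<=` F t ;
  uf_complete : forall N, P.-negligible N -> F 0 N }.

Definition stopping_time (R : realType) (T : Type) (F : R -> set (set T))
    (tau : T -> \bar R) : Prop :=
  (forall w, (0 <= tau w)%E) /\
  (forall t, 0 <= t -> F t [set w | (tau w <= t%:E)%E]).

Definition bounded_stopping_time (R : realType) (T : Type)
    (F : R -> set (set T)) (tau : T -> R) : Prop :=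
  stopping_time F (fun w => (tau w)%:E) /\ exists M, forall w, tau w <= M.

(* E carries its Borel sigma-algebra <<s open >>. *)
Definition adapted (R : realType) (T : Type) (F : R -> set (set T))
    (E : topologicalType) (xi : R -> T -> E) : Prop :=
  forall t, 0 <= t -> forall B, <<s @open E >> B -> F t (xi t @^-1` B).

Definition continuous_paths (R : realType) (T : Type) (E : topologicalType)
    (xi : R -> T -> E) : Prop :=
  forall w, {within [set t : R | 0 <= t], continuous (fun t => xi t w)}.

(* Well-posedness of the random variables rho (xi s) (xi t). It follows from
   adaptedness when E is second countable, but the Borel sigma-algebra of E * E
   can be strictly larger than the product of the Borel sigma-algebras, so that
   for a general topological space it has to be required for the expectations of
   rho (xi tau) (xi tau') to make sense. *)
Definition distance_adapted (R : realType) (T : Type) (F : R -> set (set T))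
    (E : topologicalType) (rho : E -> E -> R) (xi : R -> T -> E) : Prop :=
  forall s t, 0 <= s -> s <= t ->
    forall B : set R, measurable B ->
      F t ((fun w => rho (xi s w) (xi t w)) @^-1` B).

(* Main.v *)
Require Import Defs.
From HB Require Import structures.
From mathcomp Require Import all_boot all_order all_algebra.
From mathcomp Require Import all_classical all_reals all_analysis.
From mathcomp Require Import measurable_realfun lra ring.

(** Write X_t = rho1 (xi_t, xi_0) and Y_t = rho2 (eta_t, eta_0), with running
    suprema X* and Y* over [0, tau]. The proof is a good-lambda argument.

    Stop Y at the level b, and within that time let tau1 <= tau2 be the hitting
    times by X of the levels a and 2 gamma1 a. If X* >= 2 gamma1 a and Y* < b,
    then X moves from at most a to at least 2 gamma1 a between tau1 and tau2, so
    that rho1 (xi_tau2, xi_tau1) >= a by the quasi-triangle inequality. On the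
    other hand rho2 (eta_tau2, eta_tau1) <= 2 gamma2 b, and it vanishes unless
    X* >= a. Taking expectations and using the domination hypothesis for the
    pair tau1 <= tau2 yields [good_lambda]:
      P (X* >= 2 gamma1 a) <= P (Y* >= b) + (2 kappa gamma2 b / a) P (X* >= a).

    Apply this at the geometric levels l_k = a0 (2 gamma1)^k with b = delta l_k,
    and weight it by the jumps Phi (l_(k+1)) - Phi (l_k). As Phi (l_(k+1)) <=
    c Phi (l_k), summation by parts ([sum_shift_le]) compares the sum of the
    jumps against P (X* >= l_k) with the same sum against P (X* >= l_(k+1)) at
    the price of a factor c. When delta is so small that c times the coefficient
    2 kappa gamma2 delta is 1/2, the term in X on the right is absorbed
    ([sum_absorb]); only finitely many levels are used at a time, so that what
    is absorbed is finite. The remaining sum over Y is bounded by a multiple of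
    the expectation of Phi at Y*, by [sum_jump_le_ext0], and the sum over X
    increases with the number of levels to a bound of the expectation of Phi at
    X*, up to an error Phi (a0)
    ([ext0_le_sum_jump], [integral_le_step]). Finally a0 tends to 0, and so does
    Phi (a0). *)

Set Implicit Arguments.
Unset Strict Implicit.
Unset Printing Implicit Defensive.

Import Order.TTheory GRing.Theory Num.Theory.
Import numFieldNormedType.Exports.

Local Open Scope classical_set_scope.
Local Open Scope ring_scope.

(** * Hitting times of a continuous path *)

Definition hits (R : realType) (f : R -> R) (a s : R) : Prop :=
  exists t, [/\ 0 <= t, t <= s & a <= f t].

(** The time s always belongs to the set: the hitting time is capped at s, and
    equals s when the level is not reached. Using an earlier hitting time as the
    cap of a later one replaces taking minima of stopping times. *)
Definition hitting_time (R : realType) (f : R -> R) (a s : R) : R :=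
  inf [set t | [/\ 0 <= t, t <= s & a <= f t \/ t = s]].

Lemma path_max (R : realType) (f : R -> R) (s : R) :
  continuous f -> 0 <= s ->
  exists m, [/\ 0 <= m, m <= s & forall t, 0 <= t -> t <= s -> f t <= f m].
Proof.
move=> cf s0.
have [|m] := @EVT_max R f 0 s s0; first exact: continuous_subspaceT.
rewrite in_itv /= => /andP[m0 ms] mmax; exists m; split => // t t0 ts.
by apply: mmax; rewrite in_itv /= t0.
Qed.

Lemma le_hits (R : realType) (f : R -> R) (a b s : R) :
  a <= b -> hits f b s -> hits f a s.
Proof. by move=> ab [t [t0 ts bt]]; exists t; split => //; exact: le_trans bt. Qed.

Section hitting_time_path.
Context {R : realType} (f : R -> R) (a s : R).
Hypotheses (cf : continuous f) (s0 : 0 <= s).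

Let S := [set t | [/\ 0 <= t, t <= s & a <= f t \/ t = s]].

Let S_neq0 : S !=set0.
Proof. by exists s; split => //; right. Qed.

Let S_lbound : lbound S 0.
Proof. by move=> t []. Qed.

Let S_inf : has_inf S.
Proof. by split; [exact: S_neq0 | exists 0; exact: S_lbound]. Qed.

Lemma hitting_time_ge0 : 0 <= hitting_time f a s.
Proof. by apply: lb_le_inf; [exact: S_neq0 | exact: S_lbound]. Qed.

Lemma hitting_time_le : hitting_time f a s <= s.
Proof.
by apply: ge_inf; [case: S_inf | split => //; right].
Qed.

Lemma hitting_time_lb t : 0 <= t -> t <= s -> a <= f t -> hitting_time f a s <= t.
Proof.
by move=> t0 ts aft; apply: ge_inf; [case: S_inf | split => //; left].
Qed.

Lemma lt_hitting_time t : 0 <= t -> t < hitting_time f a s -> f t < a.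
Proof.
move=> t0 th; rewrite ltNge; apply/negP => aft.
have ts : t <= s by apply: le_trans (ltW th) hitting_time_le.
by have := hitting_time_lb t0 ts aft; rewrite leNgt th.
Qed.

(** The path is continuous, so that the set of times at which it lies above
    the level is closed and the infimum is attained. *)
Lemma hitting_time_attained :
  hitting_time f a s < s -> a <= f (hitting_time f a s).
Proof.
set h := hitting_time f a s => hs; rewrite leNgt; apply/negP => fha.
have : \forall t \near h, f t < a by have : f x @[x --> h] --> f h := @cf h; move/cvgr_lt; apply.
move=> [e /= e0 he].
have e2 : 0 < Order.min (e / 2) (s - h) by rewrite lt_min divr_gt0//= subr_gt0.
have [t [t0 ts tS] th] := inf_adherent e2 S_inf.
have ht : h <= t by apply: ge_inf; [case: S_inf | split].
have : t < h + e / 2 /\ t < s.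
  move: th; rewrite -/(hitting_time f a s) -/h -ltrBlDl lt_min => /andP[]; lra.
move=> [te ts'].
case: tS => [aft|tse]; last by move: ts'; rewrite tse ltxx.
have : f t < a by apply: he; rewrite /= ler0_norm; lra.
by rewrite ltNge aft.
Qed.

Lemma hits_hitting_time : hits f a s -> a <= f (hitting_time f a s).
Proof.
move=> [t [t0 ts aft]].
have := hitting_time_le; rewrite le_eqVlt => /orP[/eqP hs|].
  by have := hitting_time_lb t0 ts aft; rewrite hs => st;
    have -> : s = t by apply/eqP; rewrite eq_le st.
exact: hitting_time_attained.
Qed.

Lemma le_hitting_time t : f 0 <= a -> 0 <= t -> t <= hitting_time f a s -> f t <= a.
Proof.
move=> f0a t0; rewrite le_eqVlt => /orP[/eqP th|/(lt_hitting_time t0)/ltW//].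
rewrite leNgt; apply/negP => aft.
have tgt0 : 0 < t.
  by rewrite lt_neqAle t0 andbT; apply/eqP => t00; move: aft; rewrite -t00 ltNge f0a.
have : \forall u \near t, a < f u by have : f x @[x --> t] --> f t := @cf t; move/cvgr_gt; apply.
move=> [e /= e0 he].
pose u := t - Order.min (e / 2) (t / 2).
have m0 : 0 < Order.min (e / 2) (t / 2) by rewrite lt_min !divr_gt0.
have [m1 m2] : Order.min (e / 2) (t / 2) <= e / 2 /\ Order.min (e / 2) (t / 2) <= t / 2.
  by rewrite !ge_min !lexx orbT.
have afu : a < f u by apply: he; rewrite /= /u ger0_norm; lra.
have : f u < a by apply: lt_hitting_time; rewrite /u -?th; lra.
by rewrite ltNge (ltW afu).
Qed.

Lemma hitting_time_le_iff t : 0 <= t ->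
  hitting_time f a s <= t <-> s <= t \/ hits f a t.
Proof.
move=> t0; split.
  move=> ht; have := hitting_time_le; rewrite le_eqVlt => /orP[/eqP <-|hs].
    by left.
  right; exists (hitting_time f a s).
  by split => //; [exact: hitting_time_ge0 | exact: hitting_time_attained].
case=> [st|[u [u0 ut afu]]]; first exact: le_trans hitting_time_le st.
have [us|/ltW su] := leP u s; first exact: le_trans (hitting_time_lb u0 us afu) ut.
exact: le_trans hitting_time_le (le_trans su ut).
Qed.

End hitting_time_path.

Lemma hitting_time_mono (R : realType) (f : R -> R) (a b s : R) :
  continuous f -> 0 <= s -> a <= b -> hitting_time f a s <= hitting_time f b s.
Proof.
move=> cf s0 ab; rewrite leNgt; apply/negP => ba.
have h0 := @hitting_time_ge0 R f b s s0.
have : f (hitting_time f b s) < a by exact: (lt_hitting_time s0 h0).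
rewrite ltNge (le_trans ab)//; apply: hitting_time_attained => //.
exact: lt_le_trans ba (hitting_time_le _ _ s0).
Qed.

(** By compactness the level is reached as soon as every smaller level is
    exceeded, and by continuity a smaller level is exceeded at a rational time;
    since the path starts below the level, that time can be taken in [0, s). *)
Lemma hits_rat (R : realType) (f : R -> R) (a s : R) :
  continuous f -> 0 <= s -> f 0 < a ->
  hits f a s <-> forall n : nat, exists q : rat,
    [/\ 0 <= ratr q :> R, ratr q < s & a - n.+1%:R^-1 < f (ratr q)].
Proof.
move=> cf s0 f0a; split.
  move=> [t [t0 ts aft]] n.
  have tgt0 : 0 < t.
    by rewrite lt_neqAle t0 andbT; apply/eqP => t00; move: aft; rewrite -t00 leNgt f0a.
  have aft' : a - n.+1%:R^-1 < f t.
    by rewrite (lt_le_trans _ aft)// ltrBlDr ltrDl invr_gt0.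
  have : \forall u \near t, a - n.+1%:R^-1 < f u
    by have : f x @[x --> t] --> f t := @cf t; move/cvgr_gt; apply.
  move=> [e /= e0 he].
  have : Order.max 0 (t - e) < t by rewrite gt_max tgt0/=; lra.
  move=> /rat_in_itvoo[q]; rewrite in_itv /= gt_max => /andP[/andP[q0 qe] qt].
  exists q; split; [exact: ltW | exact: lt_le_trans ts |].
  by apply: he; rewrite /= ger0_norm; lra.
move=> H; have [m [m0 ms mmax]] := path_max cf s0.
exists m; split => //; apply/ler_addgt0Pr => e e0.
have [n /= ne] : exists n : nat, n.+1%:R^-1 < e.
  have /archi_boundP : 0 <= e^-1 by rewrite invr_ge0 ltW.
  set N := Num.bound _ => eN; exists N.
  rewrite invf_plt ?posrE//; apply: lt_trans eN _.
  by rewrite ltr_nat.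
have [q [q0 qs qa]] := H n.
by have := mmax _ q0 (ltW qs); move: ne qa; set d := _^-1; lra.
Qed.

(** * Hitting times as stopping times *)

Lemma measurable_hits (R : realType) (d : measure_display) (T : measurableType d)
    (Z : T -> R -> R) (tau : T -> R) (a : R) :
  (forall w, continuous (Z w)) -> (forall w, Z w 0 < a) -> (forall w, 0 <= tau w) ->
  (forall q b, 0 <= q -> measurable [set w | q < tau w /\ b < Z w q]) ->
  measurable [set w | hits (Z w) a (tau w)].
Proof.
move=> cZ Z0 tau0 mZ.
rewrite [X in measurable X](_ : _ = \bigcap_n \bigcup_q
    (if 0 <= ratr q :> R
     then [set w | ratr q < tau w /\ a - n.+1%:R^-1 < Z w (ratr q)] else set0)).
  apply: bigcap_measurable => // n _; apply: bigcupT_measurable_rat => q.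
  by case: ifPn => // q0; exact: mZ.
apply/seteqP; split => w /=.
  move/hits_rat => H n _.
  have [//|//|//|q [q0 qt aq]] := H _ _ _ n.
  by exists q => //; rewrite q0.
move=> H; apply/hits_rat => // n.
have [q _] := H n I; case: ifPn => // q0 [qt aq].
by exists q.
Qed.

Section stopping.
Context {R : realType} {d : measure_display} {T : measurableType d}.
Context {P : probability T R} {F : R -> set (set T)}.
Hypothesis hF : usual_filtration P F.

Lemma usual_filtration_measurableE t : 0 <= t -> (F t).-sigma.-measurable = F t.
Proof. by move=> t0; apply: measurable_g_measurableTypeE; exact: uf_sigma_algebra hF _ t0. Qed.

Lemma bounded_stopping_time_ge0 (tau : T -> R) w :
  bounded_stopping_time F tau -> 0 <= tau w.
Proof. by case=> -[+ _] _ => /(_ w); rewrite lee_fin. Qed.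

Lemma bounded_stopping_time_le (tau : T -> R) t :
  bounded_stopping_time F tau -> 0 <= t -> F t [set w | tau w <= t].
Proof. by case=> -[_ +] _ t0; exact. Qed.

(** The hitting time has happened by time t exactly when the path has reached
    the level on [0, t] or the time cap has passed. *)
Lemma hitting_time_stopping (Z : T -> R -> R) (tau : T -> R) (a : R) :
  (forall w, continuous (Z w)) -> (forall w, Z w 0 < a) ->
  (forall q b, 0 <= q -> F q [set w | b < Z w q]) ->
  bounded_stopping_time F tau ->
  bounded_stopping_time F (fun w => hitting_time (Z w) a (tau w)).
Proof.
move=> cZ Z0 mZ htau; have tau0 w := bounded_stopping_time_ge0 w htau.
split; last first.
  have [_ [M tauM]] := htau; exists M => w.
  exact: le_trans (hitting_time_le _ _ (tau0 w)) (tauM w).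
split=> [w|t t0]; first by rewrite lee_fin hitting_time_ge0.
rewrite (_ : [set w | _] = [set w | tau w <= t] `|` [set w | hits (Z w) a t]); last first.
  apply/seteqP; split => w /=; rewrite lee_fin.
    by move/hitting_time_le_iff; apply.
  by move=> H; apply/hitting_time_le_iff.
rewrite -usual_filtration_measurableE//; apply: measurableU.
  by rewrite usual_filtration_measurableE//; exact: bounded_stopping_time_le.
apply: (@measurable_hits R _ (g_sigma_algebraType (F t)) Z (fun=> t)) => // q b q0.
rewrite usual_filtration_measurableE//.
have [qt|tq] := ltP q t.
  rewrite (_ : [set w | _] = [set w | b < Z w q]); last first.
    by apply/seteqP; split => w //= [].
  exact: (uf_nondecreasing hF q0 (ltW qt)) (mZ q b q0).
rewrite (_ : [set w | _] = set0); last by apply/seteqP; split => w //= -[].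
by have [] := uf_sigma_algebra hF t0.
Qed.

Lemma measurable_hits_stopping (Z : T -> R -> R) (tau : T -> R) (a : R) :
  (forall w, continuous (Z w)) -> (forall w, Z w 0 < a) ->
  (forall q b, 0 <= q -> F q [set w | b < Z w q]) ->
  bounded_stopping_time F tau ->
  measurable [set w | hits (Z w) a (tau w)].
Proof.
move=> cZ Z0 mZ htau; apply: measurable_hits => // [w|q b q0].
  exact: bounded_stopping_time_ge0.
have mq A : F q A -> measurable A by exact: uf_measurable hF _ q0 A.
rewrite (_ : [set w | _] = ~` [set w | tau w <= q] `&` [set w | b < Z w q]).
  apply: measurableI; last exact/mq/mZ.
  by apply/measurableC/mq; exact: bounded_stopping_time_le.
by apply/seteqP; split => w /= -[]; [rewrite ltNge => /negP | move/negP; rewrite -ltNge].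
Qed.

End stopping.

(** * The displacement from the starting point *)

(** The absolute value extends the path to negative times, which turns
    continuity on the half-line into continuity on the whole line. *)
Definition displacement (R : realType) (T : Type) (E : topologicalType)
    (rho : E -> E -> R) (xi : R -> T -> E) (w : T) (t : R) : R :=
  rho (xi `|t| w) (xi 0 w).

Section displacement.
Context {R : realType} {d : measure_display} {T : measurableType d}.
Context {P : probability T R} {F : R -> set (set T)}.
Context {E : topologicalType} (gamma : R) (rho : E -> E -> R) (xi : R -> T -> E).
Hypotheses (hrho : quasi_metric gamma rho).

Lemma displacement0 w : displacement rho xi w 0 = 0.
Proof. by rewrite /displacement normr0; apply/(qm_eq0 hrho). Qed.

Lemma displacement_ge0 w t : 0 <= displacement rho xi w t.
Proof. exact: qm_ge0 hrho _ _. Qed.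

Lemma displacementE w t : 0 <= t -> displacement rho xi w t = rho (xi t w) (xi 0 w).
Proof. by move=> t0; rewrite /displacement ger0_norm. Qed.

Lemma displacement_continuous w : continuous_paths xi -> continuous (displacement rho xi w).
Proof.
move=> /(_ w)/subspace_continuousP cxi t.
have cxit : xi `|s| w @[s --> t] --> xi `|t| w.
  move=> A /cxi -/(_ (normr_ge0 t)) hA.
  have : `|s| @[s --> t] --> `|t| := @norm_continuous R R^o t.
  move=> /(_ _ hA) hAt.
  have {}hAt : \forall s \near t, 0 <= `|s| -> A (xi `|s| w) by exact: hAt.
  by apply: filterS hAt => s; apply.
have cp : (xi `|s| w, xi 0 w) @[s --> t] --> (xi `|t| w, xi 0 w).
  by apply: (@cvg_pair _ _ _ (nbhs t) (nbhs (xi `|t| w)) (nbhs (xi 0 w))) => //; exact: cvg_cst.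
exact: (cvg_comp _ _ cp (@qm_continuous _ _ _ _ hrho (xi `|t| w, xi 0 w))).
Qed.

Lemma displacement_adapted q b : distance_adapted F rho xi -> 0 <= q ->
  F q [set w | b < displacement rho xi w q].
Proof.
move=> dxi q0.
have := dxi 0 q (lexx _) q0 `]b, +oo[%classic (measurable_itv _).
congr (F q _); apply/seteqP; split => w /=; rewrite in_itv /= andbT displacementE//.
- by rewrite (qm_sym hrho).
- by rewrite (qm_sym hrho).
Qed.

End displacement.

(** * Moderately increasing functions along geometric levels *)

Lemma exprn_unbounded (R : realType) (lambda L : R) :
  1 < lambda -> exists n, L < lambda ^+ n.
Proof.
move=> l1; have [L0|L0] := leP L 0; first by exists 0%N; rewrite expr0 (le_lt_trans L0).
have l0 : 0 < lambda by lra.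
have : (lambda^-1 ^+ n @[n --> \oo] --> 0).
  by apply: cvg_expr; rewrite ger0_norm ?invr_ge0 ?(ltW l0)// invf_lt1.
move=> /cvgr_lt/(_ L^-1); rewrite invr_gt0 => /(_ L0)[n _ /(_ n (leqnn n)) /= hn].
by exists n; move: hn; rewrite exprVn ltf_pV2 ?posrE ?exprn_gt0.
Qed.

Lemma moderately_increasing_scale (R : realType) (Phi : R -> R) (L : R) :
  moderately_increasing Phi -> 0 < L ->
  exists2 c, 1 <= c & forall t, 0 < t -> Phi (L * t) <= c * Phi t.
Proof.
move=> hPhi L0; have [lambda l1 [c0 c00 hc]] := mi_doubling hPhi.
have l0 : 0 < lambda by lra.
have [n /ltW Ln] := exprn_unbounded L l1.
have scale_pow t : 0 < t -> Phi (lambda ^+ n * t) <= c0 ^+ n * Phi t.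
  move=> t0; elim: n {Ln} => [|n IHn]; first by rewrite !expr0 !mul1r.
  rewrite !exprS -!mulrA; apply: le_trans (hc _ _) _.
    by rewrite mulr_gt0// exprn_gt0.
  by rewrite ler_pM2l.
exists (Num.max 1 (c0 ^+ n)); first by rewrite le_max lexx.
move=> t t0; apply: (@le_trans _ _ (Phi (lambda ^+ n * t))).
  by apply: (mi_nondecreasing hPhi); rewrite ?mulr_gt0// ler_pM2r.
apply: le_trans (scale_pow t t0) _; rewrite ler_pM2r ?le_max ?lexx ?orbT//.
exact: mi_gt0 hPhi _ t0.
Qed.

Lemma ext0_nondecreasing (R : realType) (Phi : R -> R) (s t : R) :
  moderately_increasing Phi -> s <= t -> ext0 Phi s <= ext0 Phi t.
Proof.
move=> hPhi st; rewrite /ext0; case: ifPn => [s0|_].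
  by rewrite (lt_le_trans s0 st) (mi_nondecreasing hPhi).
by case: ifPn => // t0; exact/ltW/(mi_gt0 hPhi).
Qed.

Lemma ext0_ge0 (R : realType) (Phi : R -> R) (s : R) :
  moderately_increasing Phi -> 0 <= ext0 Phi s.
Proof. by move=> hPhi; rewrite /ext0; case: ifPn => // /(mi_gt0 hPhi)/ltW. Qed.

Section levels.
Context {R : realType} (Phi : R -> R) (l : nat -> R).
Hypotheses (hPhi : moderately_increasing Phi).
Hypotheses (l_gt0 : forall k, 0 < l k) (l_nondecreasing : forall k, l k <= l k.+1).

Definition jump k : R := Phi (l k.+1) - Phi (l k).

Lemma jump_ge0 k : 0 <= jump k.
Proof. by rewrite subr_ge0 (mi_nondecreasing hPhi). Qed.

Lemma sum_jump N : \sum_(k < N) jump k = Phi (l N) - Phi (l 0%N).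
Proof. by rewrite -(big_mkord xpredT jump) telescope_sumr. Qed.

Let level_le j k : (j <= k)%N -> l j <= l k.
Proof. by move: j k; apply/nondecreasing_seqP. Qed.

Let sum_jump_above N x : l N <= x ->
  \sum_(k < N.+1) jump k * (l k <= x)%R%:R = Phi (l N.+1) - Phi (l 0%N).
Proof.
move=> lx; rewrite -sum_jump; apply: eq_bigr => k _.
by rewrite (le_trans _ lx) ?mulr1//; apply: level_le; rewrite -ltnS.
Qed.

(** The sum adds up all the jumps of Phi at levels up to x, hence equals
    Phi (l (k + 1)) - Phi (l 0) for the last level l k below x, if there is one;
    otherwise x is below l 0 and the term Phi (l 0) is the bound. *)
Lemma ext0_le_sum_jump N x : x < l N ->
  ext0 Phi x <= Phi (l 0%N) + \sum_(k < N) jump k * (l k <= x)%R%:R.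
Proof.
elim: N => [|N IHN] xl.
  rewrite big_ord0 addr0; apply: le_trans (ext0_nondecreasing hPhi (ltW xl)) _.
  by rewrite /ext0 l_gt0.
have [lx|xlt] := leP (l N) x.
  rewrite sum_jump_above// addrC subrK.
  by apply: le_trans (ext0_nondecreasing hPhi (ltW xl)) _; rewrite /ext0 l_gt0.
apply: le_trans (IHN xlt) _; rewrite big_ord_recr /= lerD2l lerDl.
by rewrite mulr_ge0// jump_ge0.
Qed.

Lemma sum_jump_le_ext0 (beta : R) N x :
  0 <= beta -> (forall k, l k.+1 <= beta * l k) ->
  \sum_(k < N) jump k * (l k <= x)%R%:R <= ext0 Phi (beta * x).
Proof.
move=> b0 hl; elim: N => [|N IHN]; first by rewrite big_ord0 ext0_ge0.
have [lx|xlt] := leP (l N) x; last first.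
  by rewrite big_ord_recr /= [l N <= x]leNgt xlt mulr0 addr0.
rewrite sum_jump_above// lerBlDr -[leLHS]addr0 lerD//; last exact/ltW/(mi_gt0 hPhi).
apply: (@le_trans _ _ (ext0 Phi (l N.+1))); first by rewrite /ext0 l_gt0.
by apply: ext0_nondecreasing => //; apply: le_trans (hl N) _; rewrite ler_wpM2l.
Qed.

End levels.

(** Summation by parts turns the jumps of phi against p into phi against the
    decrements of p, where shifting phi by one index costs a factor c. *)
Lemma sum_shift_le (R : realType) (phi p : nat -> R) (c : R) N :
  1 <= c -> (forall k, 0 <= phi k) -> (forall k, phi k.+1 <= c * phi k) ->
  (forall k, 0 <= p k <= 1) -> (forall k, p k.+1 <= p k) ->
  \sum_(k < N) (phi k.+1 - phi k) * p k <=
  c * (\sum_(k < N) (phi k.+1 - phi k) * p k.+1 + phi 0%N).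
Proof.
move=> c1 phi0 phic p01 pd.
have : \sum_(k < N) (phi k.+1 - phi k) * p k - phi N * p N + phi 0%N * p 0%N <=
    c * (\sum_(k < N) (phi k.+1 - phi k) * p k.+1 - phi N * p N + phi 0%N * p 0%N).
  elim: N => [|N]; first by rewrite !big_ord0; lra.
  rewrite !big_ord_recr /=; set A := \sum_(i < _) _; set B := \sum_(i < _) _ => IHN.
  have : phi N.+1 * (p N - p N.+1) <= c * phi N * (p N - p N.+1).
    by rewrite ler_wpM2r// subr_ge0.
  lra.
have pN : phi N * p N <= c * (phi N * p N).
  by rewrite ler_peMl// mulr_ge0//; case/andP: (p01 N).
have p0 : c * (phi 0%N * p 0%N) <= c * phi 0%N.
  by rewrite ler_pM2l ?ler_piMr//; [case/andP: (p01 0%N)|lra].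
have : 0 <= phi 0%N * p 0%N by rewrite mulr_ge0//; case/andP: (p01 0%N).
lra.
Qed.

(** The sums are finite, so that the term epsilon * p k, which after the shift of
    index contributes half of the left-hand side, can be moved to the left. *)
Lemma sum_absorb (R : realType) (phi p q : nat -> R) (c epsilon : R) N :
  1 <= c -> (forall k, 0 <= phi k) -> (forall k, phi k <= phi k.+1) ->
  (forall k, phi k.+1 <= c * phi k) ->
  (forall k, 0 <= p k <= 1) -> (forall k, p k.+1 <= p k) ->
  c * epsilon = 2^-1 -> (forall k, p k.+1 <= q k + epsilon * p k) ->
  \sum_(k < N) (phi k.+1 - phi k) * p k <=
  2 * c * (\sum_(k < N) (phi k.+1 - phi k) * q k + phi 0%N).
Proof.
move=> c1 phi0 phin phic p01 pd ce hp.
have := sum_shift_le N c1 phi0 phic p01 pd.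
set A := \sum_(k < N) _ * p k; set B := \sum_(k < N) _; set Q := \sum_(k < N) _ => AB.
have BQ : B <= Q + epsilon * A.
  rewrite mulr_sumr -big_split/=; apply: ler_sum => k _.
  by rewrite mulrCA -mulrDr ler_wpM2l// subr_ge0.
have : c * B <= c * Q + 2^-1 * A.
  by rewrite -ce -mulrA -mulrDr ler_pM2l//; lra.
lra.
Qed.

(** A continuous path attains its maximum M, and the value of a nondecreasing
    function at M is the supremum of its values along the path. *)
Lemma sup_ext0_path (R : realType) (Phi f : R -> R) (s : R) :
  moderately_increasing Phi -> continuous f -> 0 <= s ->
  exists M, (forall a, hits f a s <-> a <= M) /\
    ereal_sup [set (ext0 Phi (f t))%:E | t in `[0, s]%classic] = (ext0 Phi M)%:E.
Proof.
move=> hPhi cf s0; have [m [m0 ms mmax]] := path_max cf s0.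
exists (f m); split=> [a|].
  split=> [[t [t0 ts aft]]|afm]; last by exists m.
  exact: le_trans aft (mmax t t0 ts).
apply/eqP; rewrite eq_le; apply/andP; split.
  apply: ge_ereal_sup => _ [t /= + <-]; rewrite in_itv /= => /andP[t0 ts].
  by rewrite lee_fin ext0_nondecreasing// mmax.
by apply: ereal_sup_ubound; exists m => //=; rewrite in_itv /= m0.
Qed.

(** * Integrals of possibly nonmeasurable functions *)

Section nonmeasurable.
Context {d : measure_display} {T : measurableType d} {R : realType}.
Variable mu : {measure set T -> \bar R}.

(** The integral of a nonnegative function is a supremum over the simple
    functions below it, which makes it monotone on all functions, measurable or
    not. The expectations of the suprema and of the stopped distances can thus be
    compared without studying their measurability: only the events that a level
    is hit have to be measurable. *)
Lemma le_integral_nonneg (f g : T -> \bar R) :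
  (forall x, 0 <= f x)%E -> (forall x, f x <= g x)%E ->
  (\int[mu]_x f x <= \int[mu]_x g x)%E.
Proof.
move=> f0 fg; have g0 x : (0 <= g x)%E by exact: le_trans (f0 x) (fg x).
rewrite !ge0_integralTE//; apply: ereal_sup_le => _ [h hf <-].
by exists h => // x; exact: le_trans (hf x) (fg x).
Qed.

Lemma integral_scaled_indic (k : R) (A : set T) : 0 <= k -> measurable A ->
  (\int[mu]_x (k * \1_A x)%:E = k%:E * mu A)%E.
Proof.
move=> k0 mA; rewrite (@integralZl_indic _ _ _ _ _ _ (fun=> A))//.
  by rewrite integral_indic// setIT.
by rewrite ltNge k0.
Qed.


End nonmeasurable.

Section step_functions.
Context {d : measure_display} {T : measurableType d} {R : realType}.
Variables (P : probability T R) (g : nat -> R) (A : nat -> set T).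
Hypotheses (g0 : forall k, 0 <= g k) (mA : forall k, measurable (A k)).

Let step N w : R := \sum_(k < N) g k * \1_(A k) w.

Let step_ge0 N w : 0 <= step N w.
Proof. by apply: sumr_ge0 => k _; rewrite mulr_ge0// indicE. Qed.

Let measurable_step N : measurable_fun setT (EFin \o step N).
Proof.
apply/measurable_EFinP; rewrite /step; apply: measurable_sum => k.
by apply: measurable_funM => //; exact: measurable_indic.
Qed.

Lemma integral_step N :
  (\int[P]_w (\sum_(k < N) g k * \1_(A k) w)%:E)%E =
  (\sum_(k < N) g k * fine (P (A k)))%:E.
Proof.
under eq_integral do rewrite -sumEFin.
rewrite ge0_integral_sum//.
- rewrite -sumEFin; apply: eq_bigr => k _; rewrite integral_scaled_indic//.
  by rewrite EFinM fineK// fin_num_measure.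
- move=> k; apply/measurable_EFinP; apply: measurable_funM => //; exact: measurable_indic.
- by move=> k w _; rewrite lee_fin mulr_ge0// indicE.
Qed.

Lemma step_le_integral (f : T -> \bar R) N :
  (forall w, (\sum_(k < N) g k * \1_(A k) w)%:E <= f w)%E ->
  ((\sum_(k < N) g k * fine (P (A k)))%:E <= \int[P]_w f w)%E.
Proof.
move=> gf; rewrite -integral_step; apply: le_integral_nonneg => // w.
by rewrite lee_fin step_ge0.
Qed.

(** By monotone convergence the bound passes to the limit of the step functions;
    that limit dominates f, even if no single step function does. *)
Lemma integral_le_step (f : T -> \bar R) (e M : R) :
  (forall w, 0 <= f w)%E -> 0 <= e ->
  (forall w, exists N, f w <= (e + \sum_(k < N) g k * \1_(A k) w)%:E)%E ->
  (forall N, e + \sum_(k < N) g k * fine (P (A k)) <= M) ->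
  (\int[P]_w f w <= M%:E)%E.
Proof.
move=> f0 e0 fg gM.
pose G N w := (e%:E + (step N w)%:E)%E.
have G0 N w : (0 <= G N w)%E by rewrite /G -EFinD lee_fin addr_ge0.
have mG N : measurable_fun setT (G N) by apply: emeasurable_funD => //; exact: measurable_step.
have ndG w : {homo G^~ w : n m / (n <= m)%N >-> (n <= m)%E}.
  apply/nondecreasing_seqP => n; rewrite leeD2l// lee_fin /step big_ord_recr /= lerDl.
  by rewrite mulr_ge0// indicE.
apply: (@le_trans _ _ (\int[P]_w limn (G^~ w))%E).
  apply: le_integral_nonneg => // w; have [N fN] := fg w.
  apply: le_trans fN _; rewrite EFinD -/(step N w) -/(G N w).
  rewrite (cvg_lim _ (ereal_nondecreasing_cvgn (ndG w)))//.
  by apply: ereal_sup_ubound; exists N.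
rewrite monotone_convergence//; apply: lime_le.
  apply: ereal_nondecreasing_is_cvgn => n m nm; apply: le_integral_nonneg => // w.
  exact: ndG.
apply: nearW => N; rewrite /G ge0_integralD//; last 2 first.
- by move=> w _; rewrite lee_fin step_ge0.
- exact: measurable_step.
have PT : P setT = 1%E := probability_setT P.
by rewrite integral_cst// [X in (_ * X)%E]PT mule1 integral_step -EFinD lee_fin.
Qed.

End step_functions.

(** * The distributional inequality *)

Section good_lambda.
Context {R : realType} {d : measure_display} {T : measurableType d}.
Context {P : probability T R} {F : R -> set (set T)}.
Context {E1 E2 : topologicalType} {gamma1 gamma2 kappa : R}.
Context {rho1 : E1 -> E1 -> R} {rho2 : E2 -> E2 -> R}.
Context {xi : R -> T -> E1} {eta : R -> T -> E2}.
Hypotheses (hF : usual_filtration P F) (hgamma1 : 1 <= gamma1) (hgamma2 : 1 <= gamma2).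
Hypothesis hkappa : 0 < kappa.
Hypotheses (hrho1 : quasi_metric gamma1 rho1) (hrho2 : quasi_metric gamma2 rho2).
Hypotheses (cxi : continuous_paths xi) (dxi : distance_adapted F rho1 xi).
Hypotheses (ceta : continuous_paths eta) (deta : distance_adapted F rho2 eta).
Hypothesis domination : forall tau' tau : T -> R,
  bounded_stopping_time F tau' -> bounded_stopping_time F tau ->
  (forall w, tau' w <= tau w) ->
  (\int[P]_w (rho1 (xi (tau w) w) (xi (tau' w) w))%:E <=
   kappa%:E * \int[P]_w (rho2 (eta (tau w) w) (eta (tau' w) w))%:E)%E.

Let X := displacement rho1 xi.
Let Y := displacement rho2 eta.

Let cX w : continuous (X w).
Proof. exact: (displacement_continuous hrho1). Qed.

Let cY w : continuous (Y w).
Proof. exact: (displacement_continuous hrho2). Qed.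

Let X0 w : X w 0 = 0.
Proof. exact: displacement0 hrho1 w. Qed.

Let Y0 w : Y w 0 = 0.
Proof. exact: displacement0 hrho2 w. Qed.

Let X_stopping tau a : 0 < a -> bounded_stopping_time F tau ->
  bounded_stopping_time F (fun w => hitting_time (X w) a (tau w)).
Proof.
move=> a0; apply: (hitting_time_stopping hF) => // [w|q b q0]; first by rewrite X0.
by have := displacement_adapted hrho1 b dxi q0; exact.
Qed.

Let Y_stopping tau a : 0 < a -> bounded_stopping_time F tau ->
  bounded_stopping_time F (fun w => hitting_time (Y w) a (tau w)).
Proof.
move=> a0; apply: (hitting_time_stopping hF) => // [w|q b q0]; first by rewrite Y0.
by have := displacement_adapted hrho2 b deta q0; exact.
Qed.

Lemma measurable_hits_displacement1 tau a : 0 < a -> bounded_stopping_time F tau ->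
  measurable [set w | hits (X w) a (tau w)].
Proof.
move=> a0; apply: (measurable_hits_stopping hF) => // [w|q b q0]; first by rewrite X0.
by have := displacement_adapted hrho1 b dxi q0; exact.
Qed.

Lemma measurable_hits_displacement2 tau a : 0 < a -> bounded_stopping_time F tau ->
  measurable [set w | hits (Y w) a (tau w)].
Proof.
move=> a0; apply: (measurable_hits_stopping hF) => // [w|q b q0]; first by rewrite Y0.
by have := displacement_adapted hrho2 b deta q0; exact.
Qed.

Section between_hitting_times.
Variables (tau : T -> R) (a b : R).
Hypotheses (a0 : 0 < a) (b0 : 0 < b) (htau : bounded_stopping_time F tau).

Let tau0 w := hitting_time (Y w) b (tau w).
Let tau1 w := hitting_time (X w) a (tau0 w).
Let tau2 w := hitting_time (X w) (2 * gamma1 * a) (tau0 w).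

Let tau_ge0 w : 0 <= tau w.
Proof. exact: bounded_stopping_time_ge0 htau. Qed.

Let tau0_ge0 w : 0 <= tau0 w.
Proof. exact: hitting_time_ge0. Qed.

Let gt0_gamma1 : 0 < gamma1.
Proof. exact: lt_le_trans hgamma1. Qed.

Let a_lt : a <= 2 * gamma1 * a.
Proof. by rewrite ler_peMl ?(ltW a0)//; have := hgamma1; lra. Qed.

Let tau12 w : tau1 w <= tau2 w.
Proof. exact: hitting_time_mono. Qed.

(** The displacement travels from at most a to at least 2 gamma1 a between the
    two hitting times, and the factor 2 gamma1 is what the quasi-triangle
    inequality needs to leave a distance a. *)
Let distance_ge w :
  hits (X w) (2 * gamma1 * a) (tau w) -> ~ hits (Y w) b (tau w) ->
  a <= rho1 (xi (tau2 w) w) (xi (tau1 w) w).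
Proof.
move=> hX hY.
have tau0E : tau0 w = tau w.
  apply/eqP; rewrite eq_le hitting_time_le//= leNgt; apply/negP => lt0.
  apply: hY; exists (tau0 w); split => //; first exact: ltW.
  exact: hitting_time_attained.
have X2 : 2 * gamma1 * a <= X w (tau2 w).
  by apply: hits_hitting_time => //; rewrite tau0E.
have t1 : 0 <= tau1 w by exact: hitting_time_ge0.
have X1 : X w (tau1 w) <= a by apply: (le_hitting_time _ (tau0_ge0 w)) => //; rewrite ?X0 ltW.
have := qm_triangle hrho1 (xi (tau2 w) w) (xi 0 w) (xi (tau1 w) w).
rewrite (qm_sym hrho1 (xi 0 w)) -!displacementE ?(le_trans t1)// -/X => tri.
have : gamma1 * (2 * a) <=
    gamma1 * (rho1 (xi (tau2 w) w) (xi (tau1 w) w) + X w (tau1 w)).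
  by rewrite mulrA [gamma1 * 2]mulrC; exact: le_trans X2 tri.
by rewrite ler_pM2l//; lra.
Qed.

(** The two hitting times differ only if the level a is reached, and both lie
    in the time interval on which the dominating displacement is at most b. *)
Let distance_le w : rho2 (eta (tau2 w) w) (eta (tau1 w) w) <=
  2 * gamma2 * b * \1_[set w | hits (X w) a (tau w)] w.
Proof.
have t1 : 0 <= tau1 w by exact: hitting_time_ge0.
have t2 : 0 <= tau2 w by exact: hitting_time_ge0.
have Yb t : 0 <= t -> t <= tau0 w -> Y w t <= b.
  by apply: le_hitting_time => //; rewrite Y0 ltW.
have gt0_gamma2 : 0 < gamma2 by exact: lt_le_trans hgamma2.
rewrite indicE; case: (boolP (w \in _)) => [_|]; rewrite ?mulr1 ?mulr0.
  have := qm_triangle hrho2 (eta (tau2 w) w) (eta (tau1 w) w) (eta 0 w).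
  rewrite -!displacementE// -/Y => /le_trans; apply.
  rewrite [2 * _]mulrC -mulrA ler_pM2l//.
  have := Yb _ t1 (hitting_time_le _ _ (tau0_ge0 w)).
  by have := Yb _ t2 (hitting_time_le _ _ (tau0_ge0 w)); lra.
rewrite notin_setE /= => nX.
have tau1E : tau1 w = tau0 w.
  apply/eqP; rewrite eq_le hitting_time_le//= leNgt; apply/negP => lt1.
  apply: nX; exists (tau1 w); split => //; last exact: hitting_time_attained.
  by apply: le_trans (ltW lt1) _; exact: hitting_time_le.
have -> : tau2 w = tau1 w.
  by apply/eqP; rewrite eq_le tau12 andbT tau1E hitting_time_le.
by rewrite (qm_eq0 hrho2 _ _).2.
Qed.

(** Chebyshev's inequality for the distance travelled between the two hitting
    times, at which the domination hypothesis is used. *)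
Lemma good_lambda :
  (P [set w | hits (X w) (2 * gamma1 * a)%R (tau w)] <=
   P [set w | hits (Y w) b (tau w)] +
   (2 * kappa * gamma2 * b / a)%:E * P [set w | hits (X w) a (tau w)])%E.
Proof.
set A := [set w | hits (X w) (2 * gamma1 * a) (tau w)].
set B := [set w | hits (Y w) b (tau w)].
set D := [set w | hits (X w) a (tau w)].
have mA : measurable A.
  by apply: measurable_hits_displacement1 => //; exact: lt_le_trans a_lt.
have mB : measurable B by exact: measurable_hits_displacement2.
have mD : measurable D by exact: measurable_hits_displacement1.
have mAB : measurable (A `\` B) by exact: measurableD.
have gt0_gamma2 : 0 < gamma2 by exact: lt_le_trans hgamma2.
have travelled : (a%:E * P (A `\` B) <= kappa%:E * ((2 * gamma2 * b)%:E * P D))%E.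
  have b2 : 0 <= 2 * gamma2 * b by rewrite !mulr_ge0// ltW.
  rewrite -!integral_scaled_indic ?(ltW a0)//.
  apply: (@le_trans _ _ (\int[P]_w (rho1 (xi (tau2 w) w) (xi (tau1 w) w))%:E)%E).
    apply: le_integral_nonneg => w; rewrite lee_fin.
      by rewrite mulr_ge0 ?(ltW a0)// indicE.
    rewrite indicE; case: (boolP (w \in _)) => [|_]; rewrite ?mulr1 ?mulr0.
      by rewrite inE => -[]; exact: distance_ge.
    exact: qm_ge0 hrho1 _ _.
  apply: (le_trans (domination _ _ tau12)).
  - by apply: X_stopping => //; exact: Y_stopping.
  - by apply: X_stopping; [exact: lt_le_trans a_lt | exact: Y_stopping].
  apply: lee_wpmul2l; first by rewrite lee_fin ltW.
  by apply: le_integral_nonneg => w; rewrite lee_fin; [exact: qm_ge0 hrho2 _ _|exact: distance_le].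
have AB : (P A <= P B + P (A `\` B))%E.
  apply: (@le_trans _ _ (P (B `|` (A `\` B)))); last exact: measureU2.
  apply: le_measure; rewrite ?inE//; first exact: measurableU.
  by move=> w Aw; have [Bw|nBw] := pselect (B w); [left|right].
apply: (le_trans AB); rewrite leeD2l//.
move: travelled; rewrite -(fineK (fin_num_measure P _ mAB)) -(fineK (fin_num_measure P _ mD)).
rewrite -!EFinM !lee_fin => h.
by rewrite -(ler_pM2l a0) (le_trans h)// le_eqVlt; apply/orP; left; apply/eqP; field; rewrite gt_eqF.
Qed.

End between_hitting_times.

(** The distributional inequality at the levels a0 (2 gamma1)^k, weighted by the
    jumps of Phi between these levels. The term Phi a0 accounts for the values of
    the displacement below the lowest level and vanishes as a0 tends to 0. *)
Lemma sup_moment_le (Phi : R -> R) (tau : T -> R) (c D delta a0 j : R) :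
  moderately_increasing Phi -> bounded_stopping_time F tau ->
  1 <= c -> (forall t, 0 < t -> Phi (2 * gamma1 * t) <= c * Phi t) ->
  0 < delta -> c * (2 * kappa * gamma2 * delta) = 2^-1 ->
  1 <= D -> (forall t, 0 < t -> Phi (2 * gamma1 / delta * t) <= D * Phi t) ->
  0 < a0 ->
  (\int[P]_w ereal_sup [set (ext0 Phi (Y w t))%:E | t in `[0%R, tau w]%classic] = j%:E)%E ->
  (\int[P]_w ereal_sup [set (ext0 Phi (X w t))%:E | t in `[0%R, tau w]%classic] <=
    ((1 + 2 * c) * Phi a0 + 2 * c * D * j)%:E)%E.
Proof.
move=> hPhi htau c1 hc delta0 cdelta D1 hD a00 hj.
have b2r (b1 b2 : bool) : (b1 -> b2) -> b1%:R <= b2%:R :> R.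
  by case: b1; case: b2 => // /(_ isT).
have tau_ge0 w : 0 <= tau w by exact: bounded_stopping_time_ge0 htau.
pose l k := a0 * (2 * gamma1) ^+ k.
have beta1 : 1 < 2 * gamma1 by have := hgamma1; lra.
have beta0 : 0 < 2 * gamma1 by lra.
have l_gt0 k : 0 < l k by rewrite mulr_gt0// exprn_gt0.
have lS k : l k.+1 = 2 * gamma1 * l k by rewrite /l exprS mulrCA.
have l_nd k : l k <= l k.+1 by rewrite lS ler_peMl ?ltW.
have l0E : l 0%N = a0 by rewrite /l expr0 mulr1.
have jump0 := jump_ge0 hPhi l_gt0 l_nd.
pose A k := [set w | hits (X w) (l k) (tau w)].
pose B k := [set w | hits (Y w) (delta * l k) (tau w)].
have dl_gt0 k : 0 < delta * l k by rewrite mulr_gt0.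
have mA k : measurable (A k) by exact: measurable_hits_displacement1.
have mB k : measurable (B k) by exact: measurable_hits_displacement2.
pose p k := fine (P (A k)); pose q k := fine (P (B k)).
have pE k : P (A k) = (p k)%:E by rewrite fineK// fin_num_measure.
have qE k : P (B k) = (q k)%:E by rewrite fineK// fin_num_measure.
have p01 k : 0 <= p k <= 1.
  by rewrite -!lee_fin -pE measure_ge0 probability_le1.
have pd k : p k.+1 <= p k.
  rewrite -lee_fin -!pE; apply: le_measure; rewrite ?inE//.
  by move=> w; apply: le_hits.
have hpq k : p k.+1 <= q k + 2 * kappa * gamma2 * delta * p k.
  have := good_lambda (l_gt0 k) (dl_gt0 k) htau.
  rewrite -lS -/(A k) -/(A k.+1) -/(B k) !pE qE -EFinM -EFinD lee_fin => /le_trans.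
  by apply; rewrite mulrA mulfK// gt_eqF.
have phi0 k : 0 <= Phi (l k) by exact/ltW/(mi_gt0 hPhi).
have absorbed N := @sum_absorb R (Phi \o l) p q c (2 * kappa * gamma2 * delta) N c1 phi0
  (fun k => mi_nondecreasing hPhi (l_gt0 k) (l_nd k))
  (fun k => ltac:(by rewrite /= lS; exact: hc)) p01 pd cdelta hpq.
(* the event B k is that the supremum of Y divided by delta is at least l k *)
have q_le N : \sum_(k < N) jump Phi l k * q k <= D * j.
  have D0 : 0 < D by lra.
  have DVjump k : 0 <= D^-1 * jump Phi l k by rewrite mulr_ge0// invr_ge0 ltW.
  have H f := @step_le_integral _ _ _ P _ _ DVjump mB f N.
  rewrite -ler_pdivrMl// mulr_sumr.
  under eq_bigr do rewrite mulrA.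
  rewrite -lee_fin -hj; apply: H => w.
  have [M [hM ->]] := sup_ext0_path hPhi (@cY w) (tau_ge0 w).
  rewrite lee_fin; under eq_bigr do rewrite -mulrA.
  rewrite -mulr_sumr ler_pdivrMl//.
  apply: (@le_trans _ _ (ext0 Phi (2 * gamma1 * (M / delta)))).
    have lS_le k : l k.+1 <= 2 * gamma1 * l k by rewrite lS.
    apply: le_trans (sum_jump_le_ext0 hPhi l_gt0 l_nd N (M / delta) (ltW beta0) lS_le).
    apply: ler_sum => k _; rewrite ler_wpM2l// indicE b2r//.
    by rewrite inE => /hM; rewrite ler_pdivlMr// mulrC.
  have -> : 2 * gamma1 * (M / delta) = 2 * gamma1 / delta * M by ring.
  rewrite /ext0 pmulr_rgt0 ?divr_gt0//; case: ifPn => [M0|_]; first exact: hD.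
  by rewrite mulr0.
apply: (@integral_le_step _ _ _ P _ _ jump0 mA _ (Phi (l 0%N))) => [w|||N].
- have [M [_ ->]] := sup_ext0_path hPhi (@cX w) (tau_ge0 w).
  by rewrite lee_fin ext0_ge0.
- exact: phi0 0%N.
- move=> w; have [M [hM ->]] := sup_ext0_path hPhi (@cX w) (tau_ge0 w).
  have [N hN] := exprn_unbounded (M / a0) beta1; exists N; rewrite lee_fin.
  have MlN : M < l N by rewrite /l mulrC -ltr_pdivrMr.
  apply: le_trans (ext0_le_sum_jump hPhi l_gt0 l_nd MlN) _.
  rewrite lerD2l; apply: ler_sum => k _; rewrite ler_wpM2l// indicE b2r//.
  by move=> /hM ?; rewrite inE.
- have := absorbed N; rewrite /= -/(jump Phi l _) => hA.
  have := q_le N; rewrite -(@ler_pM2l _ (2 * c)); last lra.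
  rewrite -l0E; move: hA; rewrite -/(p _) /jump; lra.
Qed.

End good_lambda.

(** * The moment inequality *)

Unset Implicit Arguments.

Theorem corollary1p4 (R : realType) (gamma1 gamma2 kappa : R) (Phi : R -> R)
    (hgamma1 : 1 <= gamma1) (hgamma2 : 1 <= gamma2) (hkappa : 0 < kappa)
    (hPhi : moderately_increasing Phi) :
  exists2 C : R, 0 < C &
  forall (d : measure_display) (T : measurableType d) (P : probability T R)
    (F : R -> set (set T))
    (E1 E2 : topologicalType) (rho1 : E1 -> E1 -> R) (rho2 : E2 -> E2 -> R)
    (xi : R -> T -> E1) (eta : R -> T -> E2),
  usual_filtration P F ->
  quasi_metric gamma1 rho1 -> quasi_metric gamma2 rho2 ->
  continuous_paths xi -> adapted F xi -> distance_adapted F rho1 xi ->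
  continuous_paths eta -> adapted F eta -> distance_adapted F rho2 eta ->
  (forall tau' tau : T -> R,
    bounded_stopping_time F tau' -> bounded_stopping_time F tau ->
    (forall w, tau' w <= tau w) ->
    (\int[P]_w (rho1 (xi (tau w) w) (xi (tau' w) w))%:E <=
     kappa%:E * \int[P]_w (rho2 (eta (tau w) w) (eta (tau' w) w))%:E)%E) ->
  forall tau : T -> R,
    bounded_stopping_time F tau -> (forall w, 0 < tau w) ->
    (\int[P]_w ereal_sup
        [set (ext0 Phi (rho1 (xi t w) (xi 0 w)))%:E | t in `[0%R, tau w]%classic] <=
     C%:E * \int[P]_w ereal_sup
        [set (ext0 Phi (rho2 (eta t w) (eta 0 w)))%:E | t in `[0%R, tau w]%classic])%E.
Proof.
have beta0 : 0 < 2 * gamma1 by lra.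
have gamma20 : 0 < gamma2 by lra.
have [c c1 hc] := moderately_increasing_scale hPhi beta0.
(* the coefficient 2 kappa gamma2 delta of the distributional inequality is
   1 / (2 c), so that half of the sum is absorbed *)
pose delta := (4 * kappa * gamma2 * c)^-1.
have delta0 : 0 < delta by rewrite invr_gt0 !mulr_gt0//; lra.
have cdelta : c * (2 * kappa * gamma2 * delta) = 2^-1.
  by rewrite /delta; field; rewrite !gt_eqF//; lra.
have [D D1 hD] := moderately_increasing_scale hPhi (divr_gt0 beta0 delta0).
have C0 : 0 < 2 * c * D by rewrite !mulr_gt0//; lra.
exists (2 * c * D) => // d T P F E1 E2 rho1 rho2 xi eta hF hrho1 hrho2
  cxi _ dxi ceta _ deta domination tau htau _.
have supE (E : topologicalType) (rho : E -> E -> R) (zeta : R -> T -> E) :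
    (fun w => ereal_sup
      [set (ext0 Phi (rho (zeta t w) (zeta 0 w)))%:E | t in `[0, tau w]%classic]) =
    (fun w => ereal_sup
      [set (ext0 Phi (displacement rho zeta w t))%:E | t in `[0, tau w]%classic]).
  apply/funext => w; congr ereal_sup; apply: eq_imagel => t.
  by rewrite /= in_itv /= => /andP[t0 _]; rewrite displacementE.
rewrite (supE _ rho1 xi) (supE _ rho2 eta).
set J := (X in (_ <= _ * X)%E).
have J0 : (0 <= J)%E.
  apply: integral_ge0 => w _.
  have [M [_ ->]] := sup_ext0_path hPhi (displacement_continuous hrho2 ceta (w := w))
    (bounded_stopping_time_ge0 w htau).
  by rewrite lee_fin ext0_ge0.
have [[j jE]|Jy] : (exists j, J = j%:E) \/ J = +oo%E.
  by case: (J) J0 => [j _|_|//]; [left; exists j | right].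
- rewrite jE -EFinM; apply/lee_addgt0Pr => e e0.
  have [a0 a00 Phia0] : exists2 a0, 0 < a0 & (1 + 2 * c) * Phi a0 < e.
    have e1 : 0 < e / (1 + 2 * c) by rewrite divr_gt0//; lra.
    have near0 : \forall s \near 0^'+, 0 < s /\ Phi s < e / (1 + 2 * c).
      near=> s; split; first by near: s; exact: nbhs_right_gt.
      by near: s; have /cvgr_lt := mi_cvg0 hPhi; apply.
    have [a0 [a00 h]] := filter_ex near0; exists a0 => //.
    by rewrite mulrC -ltr_pdivlMr//; lra.
  apply: le_trans (sup_moment_le hF hgamma1 hgamma2 hkappa hrho1 hrho2 cxi dxi ceta deta
    domination hPhi htau c1 hc delta0 cdelta D1 hD a00 jE) _.
  by rewrite -EFinD lee_fin; lra.
- by rewrite Jy gt0_muley ?lte_fin// leey.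
Unshelve. all: by end_near. Qed.
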